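(* Let $(R,m)$ be a quasi-local ring with infinite residue field $R/m$. Let $I$ be an ideal of $R$, and let $i$ and $r$ be positive integers. If the minimal number of generators $v(I^i)$ of the ideal $I^i$ satisfies \[ v(I^i) < \binom{i+r}{r}, \] then there are elements $h_1,\dots,h_r$ in $I$ such that \[ I^i = (h_1,\dots,h_r)\, I^{i-1}. \]
   Context: A quasi-local ring $(R,m)$ is a commutative ring with identity having a unique maximal ideal $m$; it is not assumed to be Noetherian. For an ideal $J$ of $R$, $v(J)$ denotes the number of minimal generators of $J$, i.e. the least cardinality of a generating set of $J$; in particular the hypothesis on $v(I^i)$ says that $I^i$ is finitely generated. The ideal $I$ itself is not assumed to be finitely generated. By convention $I^0=R$. *)

(* Defs.v *)
From HB Require Import structures.
From mathcomp Require Import all_boot all_order all_algebra.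
From mathcomp Require Import all_classical.

Set Implicit Arguments.
Unset Strict Implicit.
Unset Printing Implicit Defensive.

Import GRing.Theory.

Local Open Scope classical_set_scope.
Local Open Scope card_scope.
Local Open Scope ring_scope.

Section Ideals.
Variable R : comNzRingType.
Implicit Types (I J K M S : set R) (n k : nat).

(* MathComp's [idealr_closed] forces an ideal to be proper; the unit ideal is
   allowed here. *)
Definition is_ideal J : Prop :=
  [/\ J 0, forall x y, J x -> J y -> J (x + y) & forall a x, J x -> J (a * x)].

Definition ideal_span S : set R := smallest is_ideal S.

Definition ideal_mul I J : set R := ideal_span [set x * y | x in I & y in J].

Definition ideal_pow I n : set R := iter n (ideal_mul I) [set: R].

Definition is_maximal_ideal M : Prop :=
  [/\ is_ideal M, M <> [set: R] &
      forall J, is_ideal J -> M `<=` J -> J = M \/ J = [set: R]].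

Definition quasi_local M : Prop :=
  is_maximal_ideal M /\ forall M', is_maximal_ideal M' -> M' = M.

Definition has_gens_of_card J n : Prop :=
  exists S, S #= `I_n /\ ideal_span S = J.

(* The relation "v(J) = n", for a natural number n. It holds for no n exactly
   when J is not finitely generated. *)
Definition min_num_gens J n : Prop :=
  has_gens_of_card J n /\ forall k, has_gens_of_card J k -> (n <= k)%N.

End Ideals.

(* Main.v *)
Require Import Defs.
From HB Require Import structures.
From mathcomp Require Import all_boot all_order all_algebra.
From mathcomp Require Import all_classical.
From mathcomp Require Import ring.

(** The fibre ring of [I] is a graded algebra [G] over the infinite residue
    field, generated in degree one, with [dim G_i < 'C(i + r, r)].  The theorem
    says that [r] linear forms generate an ideal containing [G_i], and it is
    proved by a double induction on [r] and [i].  For a linear form [h],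
    multiplication by [h] gives the exact sequence
      0 -> (G/(0 : h))_(i-1) -> G_i -> (G/hG)_i -> 0,
    and Pascal's rule splits the bound as
      'C(i + r, r) = 'C(i + r - 1, r - 1) + 'C(i - 1 + r, r).
    If some [h] makes [dim (G/hG)_i] smaller than the first summand, then
    [r - 1] linear forms suffice modulo [h], and [h] is the last one.
    Otherwise, for every [h], the dimension of [(G/(0 : h))_(i-1)] is smaller
    than the second summand, and by induction there are [r] linear forms
    [g_1, ..., g_r] with [h G_(i-1)] contained in [(g_1, ..., g_r) h G_(i-2)],
    hence in [(g_1, ..., g_r) G_(i-1)].  The first containment is an open
    condition on [g].  Finitely many of the [h G_(i-1)] together span [G_i],
    and over an infinite field finitely many nonempty open conditions have a
    common point [g], which is the required tuple.

    The proof below stays inside [R].  A graded quotient of [G] is represented,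
    in the one degree [j] that matters, by the ideal [I^j] modulo an ideal [L]
    containing [m I^j]: factoring out [h] replaces [L] by [L + h I^(j-1)],
    and factoring out the annihilator of [h] replaces [L] by the colon ideal
    [L : h] and [j] by [j - 1].  The exact sequence is [gens_mod_split], the
    openness is [generic_generating], the existence of common points is
    [genericI], and the double induction is [pow_sub_add_multiples].  It is
    applied to [L = m I^i], and [nakayama] removes [L] at the end. *)

Set Implicit Arguments.
Unset Strict Implicit.
Unset Printing Implicit Defensive.

Import GRing.Theory.

Local Open Scope classical_set_scope.
Local Open Scope ring_scope.

(** * Ideals as sets *)

Section IdealSets.
Variable R : comNzRingType.
Implicit Types (I J A B L N S T : set R) (x y : R).

Lemma ideal0 J : is_ideal J -> J 0. Proof. by case. Qed.

Lemma idealD J x y : is_ideal J -> J x -> J y -> J (x + y).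
Proof. by case=> _ + _; apply. Qed.

Lemma ideal_mull J a x : is_ideal J -> J x -> J (a * x).
Proof. by case=> _ _; apply. Qed.

Lemma ideal_mulr J a x : is_ideal J -> J x -> J (x * a).
Proof. by rewrite mulrC; apply: ideal_mull. Qed.

Lemma idealN J x : is_ideal J -> J x -> J (- x).
Proof. by rewrite -mulN1r; apply: ideal_mull. Qed.

Lemma idealB J x y : is_ideal J -> J x -> J y -> J (x - y).
Proof. by move=> idJ Jx Jy; apply: idealD => //; apply: idealN. Qed.

Lemma ideal_sum J (T : finType) (P : pred T) (F : T -> R) :
  is_ideal J -> (forall i, P i -> J (F i)) -> J (\sum_(i | P i) F i).
Proof.
move=> idJ JF; elim/big_ind: _ => //; first exact: ideal0.
by move=> x y; apply: idealD.
Qed.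

Lemma ideal_congr J x y : is_ideal J -> J (x - y) -> J y -> J x.
Proof. by move=> idJ Jxy Jy; rewrite -(subrK y x); apply: idealD. Qed.

Lemma ideal_span_ideal S : is_ideal (ideal_span S).
Proof.
split=> [J [idJ _]|x y Sx Sy J [idJ SJ]|a x Sx J [idJ SJ]].
- exact: ideal0.
- by apply: idealD => //; [apply: Sx | apply: Sy].
- by apply: ideal_mull => //; apply: Sx.
Qed.

Lemma ideal_mul_ideal I J : is_ideal (ideal_mul I J).
Proof. exact: ideal_span_ideal. Qed.

Lemma ideal_mul_in I J x y : I x -> J y -> ideal_mul I J (x * y).
Proof. by move=> Ix Jy; apply: sub_gen_smallest; exists x => //; exists y. Qed.

Lemma ideal_mul_sub I J T : is_ideal T ->
  (forall x y, I x -> J y -> T (x * y)) -> ideal_mul I J `<=` T.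
Proof.
by move=> idT IJT; apply: smallest_sub => // _ [x Ix [y Jy <-]]; apply: IJT.
Qed.

Lemma ideal_pow_ideal I n : is_ideal (ideal_pow I n).
Proof. by case: n => [|n]; [split | apply: ideal_mul_ideal]. Qed.

(** The truncated predecessor is harmless here: for [n = 0] both powers are
    [R]. *)
Lemma ideal_pow_pred I n x y :
  I x -> ideal_pow I n.-1 y -> ideal_pow I n (x * y).
Proof. by case: n => [|n] //; apply: ideal_mul_in. Qed.

(** * Ideals generated modulo an ideal *)

(** This is [L + w_1 N + ... + w_n N].  With [N = R] it expresses generation
    modulo [L], with [N] a power of [I] the conclusion sought for the
    theorem, and with [L = 0] and [N = m] the product of [m] with the ideal
    generated by [w]. *)
Definition add_multiples L n (w : 'I_n -> R) N : set R :=
  [set x | exists y : 'I_n -> R,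
    (forall b, N (y b)) /\ L (x - \sum_b w b * y b)].

Lemma add_multiples_ideal L n (w : 'I_n -> R) N :
  is_ideal L -> is_ideal N -> is_ideal (add_multiples L w N).
Proof.
move=> idL idN; split=> [|x x' [y [Ny Lx]] [y' [Ny' Lx']]|a x [y [Ny Lx]]].
- exists (fun=> 0); split=> [b|]; first exact: ideal0.
  by under eq_bigr do rewrite mulr0; rewrite big1 ?subrr //; apply: ideal0.
- exists (fun b => y b + y' b); split=> [b|]; first exact: idealD.
  under eq_bigr do rewrite mulrDr.
  by rewrite big_split /= opprD addrACA; apply: idealD.
- exists (fun b => a * y b); split=> [b|]; first exact: ideal_mull.
  under eq_bigr do rewrite mulrCA.
  by rewrite -mulr_sumr -mulrBr; apply: ideal_mull.
Qed.

Lemma add_multiples_sub L n (w : 'I_n -> R) N : is_ideal N ->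
  L `<=` add_multiples L w N.
Proof.
move=> idN x Lx; exists (fun=> 0); split=> [b|]; first exact: ideal0.
by under eq_bigr do rewrite mulr0; rewrite big1 ?subr0.
Qed.

Lemma add_multiples_in L n (w : 'I_n -> R) N b y :
  is_ideal L -> is_ideal N -> N y -> add_multiples L w N (w b * y).
Proof.
move=> idL idN Ny; exists (fun c => if c == b then y else 0); split=> [c|].
  by case: ifP => // _; apply: ideal0.
rewrite (bigD1 b) //= eqxx big1 ?addr0 ?subrr; first exact: ideal0.
by move=> c /negPf ->; rewrite mulr0.
Qed.

Lemma add_multiples_cons L n h (g : 'I_n -> R) N :
  add_multiples (add_multiples L (fun _ : 'I_1 => h) N) g N `<=`
  add_multiples L (fun b : 'I_n.+1 => oapp g h (unlift ord0 b)) N.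
Proof.
move=> x [y [Ny [z [Nz Lx]]]].
exists (fun b => oapp y (z ord0) (unlift ord0 b)); split=> [b|].
  by case: (unliftP ord0 b) => [k|] _ /=; [apply: Ny | apply: Nz].
move: Lx; rewrite big_ord1 big_ord_recl unlift_none /=.
under [in X in _ -> X]eq_bigr do rewrite liftK /=.
by rewrite opprD addrA addrAC.
Qed.

Lemma set0_ideal : is_ideal [set 0 : R].
Proof.
split=> [|x y -> ->|a x ->] //=; first by rewrite addr0.
by rewrite mulr0.
Qed.

Lemma ideal_span_range s (w : 'I_s -> R) :
  ideal_span (range w) `<=` add_multiples [set 0] w setT.
Proof.
have idT : is_ideal [set: R] by split.
apply: smallest_sub; first exact: add_multiples_ideal set0_ideal idT.
move=> _ [j _ <-]; rewrite -[w j]mulr1.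
exact: add_multiples_in set0_ideal idT _.
Qed.

(** The bound on the number of generators is strict, so that it is additive in
    the same way as the binomial coefficients of Pascal's rule. *)
Definition gens_mod L A k : Prop :=
  exists s (w : 'I_s -> R),
    [/\ (s < k)%N, forall j, A (w j) & A `<=` add_multiples L w setT].

Definition colon L h : set R := [set x | L (h * x)].

Lemma colon_ideal L h : is_ideal L -> is_ideal (colon L h).
Proof.
move=> idL; split=> [|x y|a x]; rewrite /colon /=.
- by rewrite mulr0; apply: ideal0.
- by rewrite mulrDr; apply: idealD.
- by rewrite mulrCA; apply: ideal_mull.
Qed.

(** Modulo [T] the family [w] solves a homogeneous linear system, which is
    multiplied by the adjugate of [M]. *)
Lemma det_mul_in T s (M : 'M[R]_s) (w : 'I_s -> R) : is_ideal T ->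
  (forall a, T (\sum_c M a c * w c)) -> forall a, T (\det M * w a).
Proof.
move=> idT TM a.
have -> : \det M * w a = \sum_c \adj M a c * \sum_d M c d * w d.
  have -> : \det M * w a = ((\det M)%:M *m \col_c w c) a 0.
    by rewrite mul_scalar_mx !mxE.
  rewrite -mul_adj_mx -mulmxA !mxE; apply: eq_bigr => c _; congr (_ * _).
  by rewrite !mxE; apply: eq_bigr => d _; rewrite !mxE.
by apply: ideal_sum => // c _; apply: ideal_mull.
Qed.

End IdealSets.

(** * Units of a quasi-local ring *)

(** Zorn's lemma is applied to the proper ideals containing [x]. *)
Lemma quasi_local_unit (R : comNzRingType) (M : set R) x :
  quasi_local M -> ~ M x -> exists y, y * x = 1.
Proof.
move=> [_ uniqM] nMx; apply: contrapT => nx.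
(* The empty set is admitted so that the union of the empty chain qualifies. *)
pose P (J : set R) := J = set0 \/ [/\ is_ideal J, J x & ~ J 1].
have [F FP Ftot|J [PJ maxJ]] := @Zorn_bigcup R P.
  have [[X [FX [z Xz]]]|F0] := pselect (exists X, F X /\ X !=set0); last first.
    left; rewrite -subset0 => z [X FX Xz]; apply: F0.
    by exists X; split => //; exists z.
  have idF Y y : F Y -> Y y -> [/\ is_ideal Y, Y x & ~ Y 1].
    by move=> FY Yy; case: (FP _ FY) => // Y0; move: Yy; rewrite Y0.
  right; split; last first.
  - by move=> [Y FY Y1]; have [] := idF _ _ FY Y1.
  - by have [_ Xx _] := idF _ _ FX Xz; exists X.
  split=> [|y y' [Y FY Yy] [Y' FY' Yy']|a y [Y FY Yy]].
  - by have [idX _ _] := idF _ _ FX Xz; exists X => //; apply: ideal0.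
  - have [idY _ _] := idF _ _ FY Yy; have [idY' _ _] := idF _ _ FY' Yy'.
    have [YY'|Y'Y] := Ftot _ _ FY FY'.
      by exists Y' => //; apply: idealD => //; apply: YY'.
    by exists Y => //; apply: idealD => //; apply: Y'Y.
  - by have [idY _ _] := idF _ _ FY Yy; exists Y => //; apply: ideal_mull.
have Pxx : P [set a * x | a in setT].
  right; split; last by move=> [y _ yx]; apply: nx; exists y.
    split=> [|_ _ [a _ <-] [b _ <-]|b _ [a _ <-]].
    - by exists 0 => //; rewrite mul0r.
    - by exists (a + b) => //; rewrite mulrDl.
    - by exists (b * a) => //; rewrite mulrA.
  by exists 1 => //; rewrite mul1r.
case: PJ => [J0|[idJ Jx J1]].
  apply: maxJ Pxx; rewrite J0; rewrite properEneq; split; last exact: sub0set.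
  apply/eqP => /esym e.
  by have : set0 x by rewrite -e; exists 1 => //; rewrite mul1r.
suff /uniqM JM : is_maximal_ideal J by apply: nMx; rewrite -JM.
split=> // [JT|K idK JK]; first by apply: J1; rewrite JT.
have [K1|nK1] := pselect (K 1).
  by right; apply/seteqP; split=> // z _; rewrite -[z]mulr1; apply: ideal_mull.
left; apply: contrapT => KJ; apply: (maxJ K).
  by rewrite properEneq; split => //; apply/eqP => e; apply: KJ.
by right; split => //; apply: JK.
Qed.

Section ResidueField.
Variables (R : comNzRingType) (m : idealr R).
Hypothesis m_unit : forall x : R, x \notin m -> exists y, y * x = 1.
Implicit Types (I A L N S : set R) (p q : {poly R}).

Lemma m_ideal : is_ideal [set` m].
Proof.
split=> [|x y|a x] /=; [exact: idealr0 | exact: rpredD | exact: idealMr].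
Qed.

(** * Generic tuples *)

(** All but finitely many residue classes are contained in [S]: a class that
    meets the complement of [S] counts as excluded. *)
Definition cofinite_mod S : Prop :=
  finite_set [set \pi_({ideal_quot m})%qT t | t in ~` S].

Lemma cofinite_modI S S' :
  cofinite_mod S -> cofinite_mod S' -> cofinite_mod (S `&` S').
Proof.
by move=> fS fS'; rewrite /cofinite_mod setCI image_setU finite_setU.
Qed.

Lemma cofinite_mod_sub S S' :
  S `<=` S' -> cofinite_mod S -> cofinite_mod S'.
Proof.
move=> SS'; apply: sub_finite_set; apply: image_subset.
exact: subsetC.
Qed.

Lemma cofinite_mod_reflect S :
  cofinite_mod S -> cofinite_mod [set t | S (1 - t)].
Proof.
move=> fS.
suff: finite_set [set 1 - z | z in [set \pi_({ideal_quot m})%qT t | t in ~` S]].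
  apply: sub_finite_set => _ [t nSt <-].
  exists (\pi_({ideal_quot m})%qT (1 - t)); first by exists (1 - t).
  by rewrite rmorphB rmorph1 opprB addrC subrK.
exact: finite_image.
Qed.

Lemma cofinite_mod_neq0 S : infinite_set [set: {ideal_quot m}] ->
  cofinite_mod S -> S !=set0.
Proof.
move=> infR fS; apply: contrapT => S0; apply: infR.
apply: sub_finite_set fS => z _; exists (repr z); last exact: reprK.
by move=> Sz; apply: S0; exists (repr z).
Qed.

(** A polynomial over the residue field that does not vanish identically has
    finitely many roots: each root splits off a linear factor. *)
Lemma nonroots_cofinite p x0 :
  p.[x0] \notin m -> cofinite_mod [set t | p.[t] \notin m].
Proof.
have [n] := ubnP (size p); elim: n p => // n IHn p le_pn px0.
have [[s ps]|nops] := pselect (exists s, p.[s] \in m); last first.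
  have -> : [set t | p.[t] \notin m] = setT.
    apply/seteqP; split=> // t _ /=; apply/negP => pt.
    by apply: nops; exists t.
  by rewrite /cofinite_mod setCT image_set0.
have /factor_theorem[q def_q] : root (p - p.[s]%:P) s.
  by rewrite /root !hornerE subrr.
have pE t : p.[t] = q.[t] * (t - s) + p.[s].
  by rewrite -[p in LHS](subrK p.[s]%:P) def_q !hornerE.
have q0 : q.[x0] \notin m.
  apply: contra px0; rewrite pE => qx0; apply: rpredD => //.
  by rewrite mulrC idealMr.
have lt_qn : (size q < n)%N.
  have nz_q : q != 0 by apply: contraNneq q0 => ->; rewrite horner0 idealr0.
  have p_gt0 : (0 < size p)%N.
    rewrite lt0n size_poly_eq0; apply: contraNneq px0 => ->.
    by rewrite horner0 idealr0.
  have : (size (p - p.[s]%:P)%R <= size p)%N.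
    apply: leq_trans (size_polyD _ _) _; rewrite geq_max leqnn size_polyN.
    by rewrite (leq_trans (size_polyC_leq1 _)).
  rewrite def_q size_Mmonic ?monicXsubC // size_XsubC addn2 /= => le_qp.
  by rewrite -ltnS (leq_ltn_trans le_qp).
have fin := IHn q lt_qn q0.
suff : finite_set ([set \pi_({ideal_quot m})%qT s] `|`
   [set \pi_({ideal_quot m})%qT t | t in ~` [set t | q.[t] \notin m]]).
  apply: sub_finite_set => _ [t /= pt <-].
  have [qt|nqt] := boolP (q.[t] \in m).
    by right; exists t => //=; rewrite qt.
  left; apply/eqP; rewrite -Quotient.idealrBE.
  have [y yq] := m_unit nqt.
  rewrite -[t - s]mul1r -yq -mulrA idealMr //.
  have -> : q.[t] * (t - s) = p.[t] - p.[s] by rewrite pE addrK.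
  by rewrite rpredB //; apply/negPn/negP.
by rewrite finite_setU; split => //; apply: finite_set1.
Qed.

Section Generic.
Variables (I : set R) (idI : is_ideal I) (r : nat).
Implicit Types (U V : set ('I_r -> R)) (g : 'I_r -> R).

(** A substitute for Zariski openness: every line in [I^r] through a point of
    [U] stays in [U] for all but finitely many values of the parameter. *)
Definition line_open U : Prop :=
  forall g g', U g -> (forall b, I (g' b)) ->
    cofinite_mod [set t | U (fun b => g b + t * (g' b - g b))].

Definition generic V : Prop := exists U,
  [/\ U !=set0, line_open U, U `<=` [set g | forall b, I (g b)] & U `<=` V].

Lemma generic_sub V V' : V `<=` V' -> generic V -> generic V'.
Proof.
by move=> VV' [U [U0 oU UI UV]]; exists U; split => // g /UV /VV'.
Qed.

Lemma genericT : generic setT.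
Proof.
exists [set g | forall b, I (g b)]; split=> //.
  by exists (fun=> 0) => b; apply: ideal0.
move=> g g' Ig Ig'; rewrite /cofinite_mod [X in ~` X](_ : _ = setT).
  by rewrite setCT image_set0.
apply/seteqP; split=> // t _ b.
by apply: idealD => //; apply: ideal_mull => //; apply: idealB.
Qed.

Hypothesis residue_infinite : infinite_set [set: {ideal_quot m}].

(** Join a point of one open set to a point of the other by a line.  Each of
    the two sets omits only finitely many residue classes of the parameter, so
    the line has a point in both. *)
Lemma genericI V V' : generic V -> generic V' -> generic (V `&` V').
Proof.
move=> [U [[g Ug] oU UI UV]] [U' [[g' Ug'] oU' UI' UV']].
have := cofinite_modI (oU _ _ Ug (UI' _ Ug'))
  (cofinite_mod_reflect (oU' _ _ Ug' (UI _ Ug))).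
move=> /(cofinite_mod_neq0 residue_infinite)[t [/= Ut Ut']].
exists (U `&` U'); split.
- exists (fun b => g b + t * (g' b - g b)); split=> //.
  rewrite (_ : (fun b => _) =
    fun b => g' b + (1 - t) * (g b - g' b)) //.
  by apply: funext => b; ring.
- move=> h h' [Uh Uh'] Ih'.
  exact: cofinite_modI (oU _ _ Uh Ih') (oU' _ _ Uh' Ih').
- by move=> h [/UI].
- by move=> h [/UV Vh /UV' Vh'].
Qed.

Lemma generic_neq0 V : generic V -> exists2 g, V g & forall b, I (g b).
Proof. by move=> [U [[g Ug] _ UI UV]]; exists g; [apply: UV | apply: UI]. Qed.

Lemma generic_forall s (V : 'I_s -> set ('I_r -> R)) :
  (forall j, generic (V j)) -> generic [set g | forall j, V j g].
Proof.
elim: s V => [|s IHs] V gV; first by apply: generic_sub genericT => g _ [].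
apply: generic_sub (genericI (gV ord0) (IHs _ (fun j => gV (lift ord0 j)))).
by move=> g [V0 VS] j; case: (unliftP ord0 j) => [k ->|->].
Qed.

(** Openness of the condition that [A] is contained in
    [L + g_1 N + ... + g_r N].  If the generators [w_j] of [A] are written as
    combinations [\sum_b g_b z_jb] modulo [L], then moving [g] along a line
    with parameter [t] turns the vector [w] into [(1 + t E) w] modulo [L],
    with a fixed matrix [E].  The moved combinations still generate as long as
    [\det (1 + t E)] is a unit, and this polynomial in [t] has value [1]
    at [0]. *)
Lemma generic_generating A N L k g0 :
  is_ideal A -> is_ideal N -> is_ideal L ->
  (forall x y, I x -> N y -> A (x * y)) -> gens_mod L A k ->
  (forall b, I (g0 b)) -> A `<=` add_multiples L g0 N ->
  generic [set g | A `<=` add_multiples L g N].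
Proof.
move=> idA idN idL INA [s [w [_ Aw genA]]] Ig0 genA0.
exists [set g | (forall b, I (g b)) /\ A `<=` add_multiples L g N].
split; [by exists g0 | | by move=> g [] | by move=> g []].
move=> g g' [Ig gen_g] Ig'.
have /choice[z z_w] := fun j => gen_g _ (Aw j).
pose x j := \sum_b (g' b - g b) * z j b.
have Ax j : A (x j).
  apply: ideal_sum => // b _; apply: INA; last by have [] := z_w j.
  exact: idealB.
have /choice[e e_x] := fun j => genA _ (Ax j).
pose M (t : R) : 'M[R]_s := 1%:M + t *: (\matrix_(j, c) e j c).
pose P : {poly R} := \det (1%:M + 'X *: map_mx polyC (\matrix_(j, c) e j c)).
have PE t : P.[t] = \det (M t).
  rewrite /P -/(horner_eval t _) -det_map_mx; congr (\det _).
  apply/matrixP => j c; rewrite !mxE /= /horner_eval.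
  rewrite hornerD hornerM hornerX hornerC.
  by congr (_ + _); case: (j == c); rewrite ?hornerC.
have /nonroots_cofinite : P.[0] \notin m.
  by rewrite PE /M scale0r addr0 det1 idealr1.
apply: cofinite_mod_sub => t; rewrite /= PE => /m_unit[y yM].
set gt := fun b => _.
split=> [b|].
  by apply: idealD => //; apply: ideal_mull => //; apply: idealB.
set T := add_multiples L gt N.
have idT : is_ideal T by apply: add_multiples_ideal.
have LT : L `<=` T by apply: add_multiples_sub.
have Tw j : T (w j).
  rewrite -[w j]mul1r -yM -mulrA; apply: ideal_mull => //.
  apply: det_mul_in => // {}j.
  apply: (@ideal_congr _ _ _ (\sum_b gt b * z j b)) => //; last first.
    apply: ideal_sum => // b _; apply: add_multiples_in => //.
    by have [] := z_w j.
  apply: LT.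
  have -> : \sum_c M t j c * w c - \sum_b gt b * z j b =
      (w j - \sum_b g b * z j b) - t * (x j - \sum_c w c * e j c).
    have -> : \sum_b gt b * z j b = \sum_b g b * z j b + t * x j.
      rewrite mulr_sumr -big_split; apply: eq_bigr => b _ /=.
      by rewrite /gt; ring.
    have -> : \sum_c M t j c * w c = w j + t * \sum_c w c * e j c.
      rewrite mulr_sumr.
      under eq_bigr do rewrite !mxE mulrDl -mulrA [e _ _ * _]mulrC.
      rewrite big_split /= (bigD1 j) //= eqxx mul1r big1 ?addr0 // => c.
      by rewrite eq_sym => /negPf ->; rewrite mul0r.
    ring.
  have [_ Lw] := z_w j; have [_ Lx] := e_x j.
  by apply: idealB => //; apply: ideal_mull.
move=> v /genA[c [_ Lv]]; apply: (ideal_congr idT (LT _ Lv)).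
by apply: ideal_sum => // j _; apply: ideal_mulr.
Qed.

End Generic.

(** * Splitting a number of generators *)

(** Additivity of dimension for
    [0 -> N/(L : h) -> A/L -> A/(L + hN) -> 0].  Among the generators [w] of [A]
    modulo [L] choose a minimal subfamily [X] that generates modulo
    [L + hN].  Each remaining [w_d] is, modulo [L], a combination of [X] plus
    some [h y_d] with [y_d] in [N], and these [y_d] generate [N] modulo
    [L : h]. *)
Lemma gens_mod_split A N L h a b :
  is_ideal N -> is_ideal L ->
  (forall y, N y -> A (h * y)) ->
  (forall x y, x \in m -> A y -> L (x * y)) ->
  gens_mod L A (a + b) ->
  gens_mod (add_multiples L (fun _ : 'I_1 => h) N) A a \/
  gens_mod (colon L h) N b.
Proof.
move=> idN idL hNA mAL [s [w [lt_s Aw genA]]].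
set B := add_multiples _ _ _.
have idB : is_ideal B by apply: add_multiples_ideal.
have LB : L `<=` B by apply: add_multiples_sub.
pose P (X : {set 'I_s}) := forall x, A x -> exists c : 'I_s -> R,
  B (x - \sum_(j in X) w j * c j).
have PT : `[< P [set: 'I_s]%SET >].
  apply/asboolP => x /genA[c [_ Lx]]; exists c; apply: LB.
  by under eq_bigl do rewrite inE.
have [X /minsetP[/asboolP PX minX] _] :=
  @minset_exists _ (fun X => `[< P X >]) _ PT.
(* By minimality, the generators indexed by [X] are linearly independent over
   the residue field modulo [B]. *)
have indepX (c : 'I_s -> R) : B (\sum_(j in X) w j * c j) ->
    forall j, j \in X -> c j \in m.
  move=> Bc j Xj; apply: contraT => /m_unit[y yc].
  have /minX/(_ (subD1set _ _)) : `[< P (X :\ j)%SET >].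
    apply/asboolP => x /PX[d Bd]; exists (fun k => d k - y * d j * c k).
    have -> : x - \sum_(k in (X :\ j)%SET) w k * (d k - y * d j * c k) =
        (x - \sum_(k in X) w k * d k) +
        y * d j * \sum_(k in X) w k * c k.
      rewrite (big_setD1 j Xj) [in RHS](big_setD1 j Xj) /=.
      under eq_bigr do rewrite mulrBr.
      rewrite sumrB [in RHS]mulrDr [in X in _ = _ + (_ + X)]mulr_sumr.
      under [in X in _ = _ + (_ + X)]eq_bigr do rewrite mulrCA.
      ring: yc.
    by apply: idealD => //; apply: ideal_mull.
  by move/setP/(_ j); rewrite Xj !inE eqxx.
have [lt_Xa|le_aX] := ltnP #|X| a.
  left; exists #|X|, (fun j => w (enum_val j)); split=> // x /PX[c Bx].
  exists (fun j => c (enum_val j)); split=> //.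
  by rewrite -(big_enum_val (fun j => w j * c j)).
right.
have /choice[c Bc] := fun d => PX _ (Aw d).
have /choice[y y_c] := fun d => Bc d.
have Ny d : N (y d ord0) by have [] := y_c d.
have Lu d : L (w d - \sum_(j in X) w j * c d j - h * y d ord0).
  by have [_] := y_c d; rewrite big_ord1.
exists #|(~: X)%SET|, (fun j => y (enum_val j) ord0); split=> //.
  by rewrite -(ltn_add2l #|X|) cardsC card_ord (leq_trans lt_s) ?leq_add2r.
move=> x Nx; have [e [_ Le]] := genA _ (hNA _ Nx).
exists (fun j => e (enum_val j)); split=> //.
rewrite -(big_enum_val (fun j => y j ord0 * e j)) /colon /=.
pose f j := e j + \sum_(d in (~: X)%SET) c d j * e d.
(* Eliminating the [w_d] with [d] outside [X] leaves a combination of [X] with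
   coefficients [f], which lies in [B], so that [f] has values in [m]. *)
have hxE : h * (x - \sum_(d in (~: X)%SET) y d ord0 * e d) =
    (h * x - \sum_d w d * e d) +
    \sum_(d in (~: X)%SET)
      e d * (w d - \sum_(j in X) w j * c d j - h * y d ord0) +
    \sum_(j in X) w j * f j.
  have wf : \sum_(j in X) w j * f j = \sum_(j in X) w j * e j +
      \sum_(d in (~: X)%SET) e d * \sum_(j in X) w j * c d j.
    under eq_bigr do rewrite mulrDr; rewrite big_split /=; congr (_ + _).
    under eq_bigr do rewrite mulr_sumr; rewrite exchange_big /=.
    apply: eq_bigr => d _; rewrite mulr_sumr; apply: eq_bigr => j _; ring.
  have wX : \sum_d w d * e d =
      \sum_(j in X) w j * e j + \sum_(d in (~: X)%SET) e d * w d.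
    rewrite (bigID (mem X)) /=; congr (_ + _).
    by apply: eq_big => d; [rewrite inE | rewrite mulrC].
  have hyE : h * \sum_(d in (~: X)%SET) y d ord0 * e d =
      \sum_(d in (~: X)%SET) e d * (h * y d ord0).
    by rewrite mulr_sumr; apply: eq_bigr => d _; ring.
  under [X in _ = _ + X + _]eq_bigr do rewrite !mulrBr.
  by rewrite wX wf mulrBr hyE !sumrB; ring.
have Lu' : L (\sum_(d in (~: X)%SET)
    e d * (w d - \sum_(j in X) w j * c d j - h * y d ord0)).
  by apply: ideal_sum => // d _; apply: ideal_mull.
rewrite hxE; apply: idealD => //; first exact: idealD.
apply: ideal_sum => // j Xj; rewrite mulrC; apply: mAL => //.
apply: indepX Xj => //.
apply: (@ideal_congr _ _ _
  (h * (x - \sum_(d in (~: X)%SET) y d ord0 * e d))) => //.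
  rewrite hxE opprD addrCA subrr addr0.
  by apply: idealN => //; apply: LB; apply: idealD.
exists (fun=> x - \sum_(d in (~: X)%SET) y d ord0 * e d); split.
  move=> _; apply: idealB => //.
  by apply: ideal_sum => // d _; apply: ideal_mulr.
by rewrite big_ord1 subrr; apply: ideal0.
Qed.

(** * The double induction *)

(** For [j = 0] the truncated predecessor makes the conclusion
    read [R = L + g_1 R + ... + g_r R].  So the induction can start in degree
    zero, where fewer than one generator modulo [L] forces [L = R]. *)
Lemma pow_sub_add_multiples I r j L :
  infinite_set [set: {ideal_quot m}] -> is_ideal I -> is_ideal L ->
  (forall x y, x \in m -> ideal_pow I j y -> L (x * y)) ->
  gens_mod L (ideal_pow I j) 'C(j + r, r) ->
  exists g : 'I_r -> R, (forall b, I (g b)) /\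
    ideal_pow I j `<=` add_multiples L g (ideal_pow I j.-1).
Proof.
move=> infR idI; have idX := ideal_pow_ideal I.
(* For [r = 0] and for [j = 0] the binomial coefficient is [1], which leaves no
   generator at all. *)
have base n k K : is_ideal K -> gens_mod K (ideal_pow I k) 1 ->
    exists g : 'I_n -> R, (forall b, I (g b)) /\
      ideal_pow I k `<=` add_multiples K g (ideal_pow I k.-1).
  move=> idK [s [w [s_lt1 _ genX]]]; exists (fun=> 0); split=> [_|x].
    exact: ideal0.
  case: s w s_lt1 genX => // w _ genX /genX[c [_]].
  by rewrite big_ord0 subr0; apply: add_multiples_sub.
elim: r j L => [|r IHr] j L; first by rewrite bin0 => idL _; apply: base.
elim: j L => [|j IHj] L idL mL; first by rewrite add0n binn; apply: base.
have -> : 'C(j.+1 + r.+1, r.+1) = ('C(j.+1 + r, r) + 'C(j + r.+1, r.+1))%N.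
  by rewrite addSn binS addnC addSnnS.
move=> genL.
pose Lh h := add_multiples L (fun _ : 'I_1 => h) (ideal_pow I j).
have [[h [Ih genLh]]|nogen] := pselect (exists h, I h /\
    gens_mod (Lh h) (ideal_pow I j.+1) 'C(j.+1 + r, r)).
  have idLh : is_ideal (Lh h) by apply: add_multiples_ideal.
  have [|g [Ig Xg]] := IHr _ _ idLh _ genLh.
    by move=> x y mx Xy; apply: add_multiples_sub => //; apply: mL.
  exists (fun b => oapp g h (unlift ord0 b)); split=> [b|x /Xg].
    by case: (unliftP ord0 b) => [k|] _ /=; [apply: Ig | apply: Ih].
  exact: add_multiples_cons.
(* In the remaining case every product [h * y] with [h] in [I] and [y] in [I^j]
   lies in the sum of [L] and the [g_b I^j] for generic [g]; the set of
   elements with this property is an ideal, since generic sets intersect. *)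
have genX x : ideal_pow I j.+1 x -> generic I
    [set g : 'I_r.+1 -> R | add_multiples L g (ideal_pow I j) x].
  pose V y := [set g : 'I_r.+1 -> R |
    add_multiples L g (ideal_pow I j) y].
  have idg (g : 'I_r.+1 -> R) := add_multiples_ideal g idL (idX j).
  apply: (@ideal_mul_sub _ _ _ [set y | generic I (V y)]).
    split=> [|y z Vy Vz|a y Vy] /=.
    - apply: generic_sub (genericT idI _) => g _.
      exact: ideal0.
    - apply: generic_sub (genericI infR Vy Vz) => g [].
      exact: idealD.
    - by apply: generic_sub Vy => g; apply: ideal_mull.
  move=> h y Ih Xy /=.
  have Xh z : ideal_pow I j z -> ideal_pow I j.+1 (h * z).
    exact: ideal_mul_in.
  have [//|] := gens_mod_split (idX j) idL Xh mL genL.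
    by move=> gh; case: nogen; exists h.
  move=> genX.
  have idLc := colon_ideal h idL.
  have [|g [Ig Xg]] := IHj _ idLc _ genX.
    by move=> x' z mx' Xz; rewrite /colon /= mulrCA; apply: mL => //; apply: Xh.
  have := generic_generating idI (idX j) (idX j.-1) idLc
    (@ideal_pow_pred _ I j) genX Ig Xg.
  apply: generic_sub.
  move=> g' /(_ y Xy)[z [Xz Lz]].
  exists (fun b => h * z b); split=> [b|].
    exact: ideal_pow_pred.
  under eq_bigr do rewrite mulrCA.
  by rewrite -mulr_sumr -mulrBr.
have [s [w [_ Xw genw]]] := genL.
have [g Vg Ig] :=
  generic_neq0 (generic_forall idI infR (fun b => genX _ (Xw b))).
have idT := add_multiples_ideal g idL (idX j).
exists g; split=> // x /genw[c [_ Lx]] /=.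
apply: (ideal_congr idT (add_multiples_sub g (idX j) Lx)).
by apply: ideal_sum => // b _; exact: ideal_mulr idT (Vg b).
Qed.

(** * Nakayama's lemma *)

(** The determinant trick: modulo [T] the generators satisfy
    [(1 - e) w = 0] for a matrix [e] with entries in [m], and [\det (1 - e)] is
    [1] in the residue field, hence a unit. *)
Lemma nakayama A T s (w : 'I_s -> R) :
  is_ideal T -> A `<=` ideal_span (range w) -> (forall j, A (w j)) ->
  (forall x, A x -> exists2 y, ideal_mul [set` m] A y & T (x - y)) ->
  A `<=` T.
Proof.
move=> idT Aw wA nak.
have mA : ideal_mul [set` m] A `<=` add_multiples [set 0] w [set` m].
  apply: ideal_mul_sub; first exact: add_multiples_ideal (set0_ideal R) m_ideal.
  move=> x y mx /Aw/ideal_span_range[c [_ yE]].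
  exists (fun k => x * c k); split=> [k|]; first exact: ideal_mulr m_ideal _.
  under eq_bigr do rewrite mulrCA.
  by rewrite -mulr_sumr -mulrBr yE mulr0.
have /choice[e we] : forall j, exists e : 'I_s -> R,
    (forall k, e k \in m) /\ T (w j - \sum_k w k * e k).
  move=> j; have [y /mA[e [me /subr0_eq yE]] Ty] := nak _ (wA j).
  by exists e; split=> //; rewrite -yE.
pose M : 'M[R]_s := 1%:M - \matrix_(j, k) e j k.
have nM : \det M \notin m.
  pose pi : {rmorphism R -> {ideal_quot m}} := \pi_({ideal_quot m})%qT.
  have pi_M : pi (\det M) = 1.
    rewrite -det_map_mx -(det1 _ s); congr (\det _).
    apply/matrixP => j k; rewrite !mxE rmorphB rmorph_nat.
    have [me _] := we j.
    have -> : pi (e j k) = 0; last by rewrite subr0.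
    by rewrite -(rmorph0 pi); apply/eqP; rewrite -Quotient.idealrBE subr0.
  have : \det M - 1 \in m.
    by rewrite Quotient.idealrBE -/(pi _) pi_M -(rmorph1 pi).
  by apply: contraL => Mm; apply/negP => /(rpredB Mm); rewrite subKr idealr1.
have [y yM] := m_unit nM.
have Tw j : T (w j).
  rewrite -[w j]mul1r -yM -mulrA; apply: ideal_mull => //.
  apply: (det_mul_in idT) => {}j.
  have -> : \sum_c M j c * w c = w j - \sum_k w k * e j k; last first.
    by have [] := we j.
  under eq_bigr do rewrite !mxE mulrBl [e _ _ * _]mulrC.
  rewrite sumrB (bigD1 j) //= eqxx mul1r big1 ?addr0 // => c.
  by rewrite eq_sym => /negPf ->; rewrite mul0r.
move=> x /Aw; apply: smallest_sub; first exact: idT.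
by move=> _ [j _ <-].
Qed.

End ResidueField.

Theorem theorem2p1 (R : comNzRingType) (m : idealr R)
    (Rlocal : quasi_local [set` m])
    (residue_infinite : infinite_set [set: {ideal_quot m}])
    (I : set R) (Iideal : is_ideal I)
    (i r : nat) (i_gt0 : (0 < i)%N) (r_gt0 : (0 < r)%N)
    (v : nat) (v_def : min_num_gens (ideal_pow I i) v)
    (v_lt : (v < 'C(i + r, r))%N) :
  exists h : 'I_r -> R,
    (forall j, I (h j)) /\
    ideal_pow I i = ideal_mul (ideal_span (range h)) (ideal_pow I i.-1).
Proof.
have m_unit x : x \notin m -> exists y, y * x = 1.
  by move=> /negP nmx; apply: quasi_local_unit Rlocal nmx.
have [[S [S_card S_gen]] _] := v_def.
have [w wS] : exists w : 'I_v -> R, range w = S.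
  have /card_set_bijP[f [fS f_inj f_surj]] := S_card.
  have /choice[w Sw] : forall j : 'I_v, exists x, S x /\ f x = j.
    by move=> j; have [x Sx fx] := f_surj j (ltn_ord j); exists x.
  exists w; apply/seteqP; split=> [_ [j _ <-]|x Sx]; first by have [] := Sw j.
  have [Swx fwx] := Sw (Ordinal (fS x Sx)).
  by exists (Ordinal (fS x Sx)) => //; apply: f_inj; rewrite ?inE.
have wX j : ideal_pow I i (w j).
  by rewrite -S_gen -wS; apply: sub_gen_smallest; exists j.
have Xw : ideal_pow I i `<=` ideal_span (range w) by rewrite wS S_gen.
pose L := ideal_mul [set` m] (ideal_pow I i).
have idL : is_ideal L by apply: ideal_mul_ideal.
have mL x y : x \in m -> ideal_pow I i y -> L (x * y).
  exact: (@ideal_mul_in _ [set` m]).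
have genL : gens_mod L (ideal_pow I i) 'C(i + r, r).
  exists v, w; split=> // x /Xw/ideal_span_range[c [cT xE]].
  by exists c; split=> //; rewrite xE; apply: ideal0.
have [h [Ih Xh]] :=
  pow_sub_add_multiples m_unit residue_infinite Iideal idL mL genL.
exists h; split=> //.
set T := ideal_mul _ _; have idT : is_ideal T by apply: ideal_mul_ideal.
apply/seteqP; split; last first.
  apply: ideal_mul_sub; first exact: ideal_pow_ideal.
  move=> x y hx Xy; apply: ideal_pow_pred => //.
  by apply: smallest_sub hx => // _ [b _ <-].
apply: (nakayama m_unit idT Xw wX) => x /Xh[y [Xy Lx]].
exists (x - \sum_b h b * y b) => //; rewrite subKr.
apply: ideal_sum => // b _; apply: ideal_mul_in => //.
by apply: sub_gen_smallest; exists b.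
Qed.
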